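(* The family $\mathbf{I}(\geq,>,-)$ grows according to the following succession rule: \[\Omega_{semi}=\left\{\begin{array}{l}(1,1)\\ (h,k)\rightsquigarrow (h,k+1),\ldots,(1,k+1),\ (h+1,k),\ldots,(h+k,1).\end{array}\right.\]
   Context: An inversion sequence of length (size) $n\ge 1$ is an integer sequence $e=(e_1,\ldots,e_n)$ with $0\le e_i<i$ for all $i$. $\mathbf{I}(\geq,>,-)$ is the set of inversion sequences for which there are no three indices $i<j<k$ with $e_i\ge e_j$ and $e_j>e_k$. A generating tree for a combinatorial class $\mathcal{C}$ (with finitely many objects of each size and exactly one object of size $1$) is an infinite rooted tree whose vertices are the objects of $\mathcal{C}$, each appearing exactly once, with objects of size $n$ at level $n$ (the root being at level $1$); the children of an object $c$ are obtained by adding to $c$ an atom (a piece of object increasing the size by $1$) following some prescribed rules. A succession rule consists of a starting label (the axiom) and, for each label, a multiset of produced labels (its productions). The class $\mathcal{C}$ grows according to a succession rule $\Omega$ if there are a generating tree for $\mathcal{C}$ and an assignment of labels to the objects of $\mathcal{C}$ such that the root carries the axiom and, for each object with label $\ell$, the multiset of labels of its children is exactly the multiset of productions of $\ell$ in $\Omega$. In the rule above, the axiom is $(1,1)$ and label $(h,k)$ produces $(i,k+1)$ once for each $1\le i\le h$, and $(h+i,k+1-i)$ once for each $1\le i\le k$. *)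

(* Defs.v *)
From mathcomp Require Import all_boot.

Set Implicit Arguments.
Unset Strict Implicit.
Unset Printing Implicit Defensive.

(** [adds_atom c d] means that [d] can be obtained from [c] by adding one
    atom; what an atom is belongs to the description of the class. *)
Record comb_class := CombClass {
  object :> eqType;
  osize : object -> nat;
  adds_atom : object -> object -> Prop;
  osize_gt0 : forall c, 0 < osize c;
  osize_finite : forall n, exists s : seq object,
    forall c, (c \in s) = (osize c == n);
  osize1_unique : exists! c, osize c = 1;
  adds_atom_size : forall c d, adds_atom c d -> osize d = (osize c).+1
}.

(** The vertices of the tree are the objects themselves, so that each one
    appears exactly once.  "Rooted tree" is: every vertex is the end of exactly
    one directed path from the root.  A path [p] does not list its starting
    vertex, so a path of [size p] edges ends at level [(size p).+1]. *)
Record generating_tree (C : comb_class) := GeneratingTree {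
  root : C;
  children : C -> seq C;
  children_uniq : forall c, uniq (children c);
  tree_path : forall c, exists! p : seq C,
    path (fun x y => y \in children x) root p /\ last root p = c;
  tree_level : forall p : seq C, path (fun x y => y \in children x) root p ->
    osize (last root p) = (size p).+1;
  tree_infinite : forall n, exists c : C, n < osize c;
  children_atom : forall c d, d \in children c -> adds_atom c d
}.

(** The multiset of productions is a list, only used up to [perm_eq]. *)
Record succession_rule := SuccessionRule {
  label : eqType;
  axiom_label : label;
  productions : label -> seq label
}.

Definition grows_according_to (C : comb_class) (Omega : succession_rule) :=
  exists (T : generating_tree C) (lab : C -> label Omega),
    lab (root T) = axiom_label Omega /\
    forall c : C,
      perm_eq [seq lab d | d <- children T c] (productions (lab c)).

Definition Omega_semi : succession_rule :=
  @SuccessionRule (nat * nat)%type (1, 1)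
    (fun hk => let: (h, k) := hk in
      [seq (i, k + 1) | i <- iota 1 h] ++
      [seq (h + i, k + 1 - i) | i <- iota 1 k]).

(** Positions are numbered from 0: the usual condition [e_i < i] on 1-based
    positions reads [nth 0 e i <= i]. *)
Definition inversion_sequence (e : seq nat) : bool :=
  (0 < size e) && [forall i : 'I_(size e), nth 0 e i <= i].

Definition avoids_geq_gt (e : seq nat) : bool :=
  ~~ [exists i : 'I_(size e), exists j : 'I_(size e), exists k : 'I_(size e),
      [&& i < j, j < k, nth 0 e i >= nth 0 e j & nth 0 e j > nth 0 e k]].

Definition inv_geq_gt : eqType :=
  {e : seq nat | inversion_sequence e && avoids_geq_gt e}.

(** The atom is an entry, inserted anywhere; the other entries keep their
    values. *)
Definition inserts_entry (e f : seq nat) : Prop :=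
  exists i x, i <= size e /\ f = take i e ++ x :: drop i e.

Lemma inv_geq_gt_size_gt0 (c : inv_geq_gt) : 0 < size (val c).
Proof. by case: c => e /= /andP[/andP[]]. Qed.

Lemma inv_geq_gt_finite n : exists s : seq inv_geq_gt,
  forall c, (c \in s) = (size (val c) == n).
Proof.
pose L := [seq map val (tval t) | t : n.-tuple 'I_n].
exists (pmap insub L) => c; rewrite mem_pmap_sub; apply/imageP/eqP.
  by case=> t _ ->; rewrite size_map size_tuple.
move=> sz; have /andP[/andP[_ /forallP le_e] _] := valP c.
have lt_e : all (fun x => x < n) (val c).
  apply/(all_nthP 0) => i lti; rewrite -sz.
  exact: leq_ltn_trans (le_e (Ordinal lti)) lti.
have sz' : size (pmap (insub : nat -> option 'I_n) (val c)) == n.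
  rewrite size_pmap_sub -[X in _ == X]sz.
  by move: lt_e; rewrite all_count.
exists (Tuple sz') => //=.
rewrite pmap_filter; last exact: insubK.
by apply/esym/all_filterP; apply: sub_all lt_e => x ltx; rewrite insubT.
Qed.

Lemma inv_geq_gt_size1 : exists! c : inv_geq_gt, size (val c) = 1.
Proof.
have P0 : inversion_sequence [:: 0] && avoids_geq_gt [:: 0].
  apply/andP; split; first by apply/andP; split=> //; apply/forallP=> -[[]].
  apply/existsPn => -[[|//] ?]; apply/existsPn => -[[|//] ?].
  by apply/existsPn => -[[|//] ?].
exists (exist _ [:: 0] P0); split=> // c sz; apply: val_inj => /=.
case: c sz => -[|x [|y s]] //= /andP[/andP[_ /forallP/(_ ord0)]] /=.
by rewrite leqn0 => /eqP ->.
Qed.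

Lemma inserts_entry_size e f : inserts_entry e f -> size f = (size e).+1.
Proof.
case=> i [x [lei ->]]; rewrite size_cat /= size_drop size_takel //.
by rewrite addnS subnKC.
Qed.

Definition I_geq_gt : comb_class :=
  @CombClass inv_geq_gt (fun c => size (val c))
    (fun c d => inserts_entry (val c) (val d))
    inv_geq_gt_size_gt0 inv_geq_gt_finite inv_geq_gt_size1
    (fun c d => @inserts_entry_size (val c) (val d)).

(* Main.v *)
Require Import Defs.
From mathcomp Require Import all_boot.
From mathcomp Require Import zify.

Set Implicit Arguments.
Unset Strict Implicit.
Unset Printing Implicit Defensive.

(** The tree grows a sequence [e] of size [n] by appending a new last entry [x],
    with [0 <= x <= n].  Let [top e] be the maximum of [e], and let [floor e] be
    the maximum of the entries [e_j] with some [e_i >= e_j] to their left, that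
    is, of the entries that can play the middle role in a forbidden pattern.
    Appending [x] creates a pattern exactly when some such [e_j] exceeds [x], so
    the admissible values are [floor e <= x <= n] ([valid_rcons]).  Since
    [floor e <= top e < n], they split at [top e] into

    - [h = top e - floor e + 1] values [x <= top e]: the new entry is dominated
      by the maximum, hence [x] is the new floor and [top e] is unchanged; the
      labels become [(top e - x + 1, k + 1)], that is [(h, k + 1)], ...,
      [(1, k + 1)];
    - [k = n - top e] values [x = top e + i], with [1 <= i <= k]: the floor is
      unchanged and [x] is the new maximum; the labels become
      [(h + i, k + 1 - i)].

    So [(h, k)] is a label that follows the rule ([labels_children]).
    Conversely, a nonempty prefix of an admissible sequence is admissible, so
    deleting the last entry recovers the parent, which makes this a tree. *)

(** * Largest entry and least admissible new entry *)

Definition top (e : seq nat) := \max_(x <- e) x.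

(** With no entry to take the maximum over, the value is [0], which is then the
    least admissible new entry. *)
Definition floor (e : seq nat) :=
  \max_(0 <= j < size e | has (leq (nth 0 e j)) (take j e)) nth 0 e j.

Lemma leq_top e y : y \in e -> y <= top e.
Proof. by move=> ye; apply: (@leq_bigmax_seq _ e predT id y ye isT). Qed.

Lemma has_leq_top e x : 0 < size e -> has (leq x) e = (x <= top e).
Proof.
move=> e_gt0; apply/hasP/idP => [[y ye lexy]|].
  exact: leq_trans lexy (leq_top ye).
move=> le_xt; apply/hasP; apply: contraTT le_xt => /hasPn Nle; rewrite -ltnNge.
have x_gt0 : 0 < x.
  by case: e e_gt0 Nle => // y s _ /(_ y (mem_head _ _)); lia.
rewrite -(prednK x_gt0) ltnS; apply/bigmax_leqP_seq => y /Nle.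
by rewrite -ltnNge => + _; lia.
Qed.

Lemma top_rcons e x : top (rcons e x) = maxn (top e) x.
Proof. by rewrite /top big_rcons /= maxnC. Qed.

(** The earlier entries keep their status, and the new one is dominated by an
    entry on its left exactly when it is at most the maximum. *)
Lemma floor_rcons e x : 0 < size e ->
  floor (rcons e x) = if x <= top e then maxn (floor e) x else floor e.
Proof.
move=> e_gt0; rewrite /floor size_rcons big_mkcond big_nat_recr //=.
rewrite nth_rcons ltnn eqxx -cats1 take_size_cat // has_leq_top //.
rewrite [in RHS]big_mkcond (@eq_big_nat _ _ _ _ _ _
  (fun j => if has (leq (nth 0 e j)) (take j e) then nth 0 e j else 0)).
  by case: ifP => //= _; rewrite maxn0.
by move=> j /andP[_ ltj]; rewrite nth_cat ltj takel_cat // ltnW.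
Qed.

Lemma floor_le_top e : floor e <= top e.
Proof.
rewrite /floor big_nat_cond; apply/bigmax_leqP_seq => j _ /andP[/andP[_ ltj] _].
exact/leq_top/mem_nth.
Qed.

Lemma floor_leP e b :
  reflect (forall i j, i < j -> j < size e -> nth 0 e j <= nth 0 e i ->
             nth 0 e j <= b)
          (floor e <= b).
Proof.
rewrite /floor; apply: (iffP (bigmax_leqP_seq _ _ _ _)) => le_b.
  move=> i j ltij ltj leji; apply: (le_b j); first by rewrite mem_index_iota.
  apply/hasP; exists (nth 0 e i) => //.
  by rewrite -(nth_take 0 ltij) mem_nth // size_takel // ltnW.
move=> j; rewrite mem_index_iota /= => ltj /(hasP)[y /(nthP 0)[i]].
rewrite size_takel ?(ltnW ltj) // => ltij; rewrite nth_take // => <-.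
exact: le_b.
Qed.

(** * Admissible last entries *)

Definition valid e := inversion_sequence e && avoids_geq_gt e.

Lemma inversion_sequenceP e : 0 < size e ->
  reflect (forall i, i < size e -> nth 0 e i <= i) (inversion_sequence e).
Proof.
rewrite /inversion_sequence => -> /=; apply: (iffP forallP) => le_e i.
  by move=> lti; apply: (le_e (Ordinal lti)).
exact: le_e.
Qed.

Lemma avoids_geq_gtP e :
  reflect (forall i j k, i < j -> j < k -> k < size e ->
             nth 0 e j <= nth 0 e i -> nth 0 e j <= nth 0 e k)
          (avoids_geq_gt e).
Proof.
apply: (iffP idP) => [av i j k ij jk kn le_ji|av].
  rewrite leqNgt; apply: contraNN av => lt_kj.
  have jn := ltn_trans jk kn; have in_ := ltn_trans ij jn.
  apply/existsP; exists (Ordinal in_); apply/existsP; exists (Ordinal jn).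
  by apply/existsP; exists (Ordinal kn); apply/and4P.
apply/existsP => -[i /existsP[j /existsP[k /and4P[ij jk le_ji]]]].
by rewrite ltnNge (av i j k).
Qed.

Lemma inversion_sequence_rcons e x : 0 < size e ->
  inversion_sequence (rcons e x) = inversion_sequence e && (x <= size e).
Proof.
move=> e_gt0; have ex_gt0 : 0 < size (rcons e x) by rewrite size_rcons.
apply/(inversion_sequenceP ex_gt0)/andP => [|[]]; rewrite size_rcons.
  move=> le_ex.
  split; last by have := le_ex _ (ltnSn _); rewrite nth_rcons ltnn eqxx.
  apply/(inversion_sequenceP e_gt0) => i lti.
  by have := le_ex i (ltnW lti); rewrite nth_rcons lti.
move=> /(inversion_sequenceP e_gt0) le_e lex i; rewrite ltnS nth_rcons.
by case: ltngtP => [/le_e //| |->].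
Qed.

(** A pattern created by the new entry uses it as its last, smallest entry. *)
Lemma avoids_geq_gt_rcons e x :
  avoids_geq_gt (rcons e x) = avoids_geq_gt e && (floor e <= x).
Proof.
apply/avoids_geq_gtP/andP => [|[/avoids_geq_gtP av]]; rewrite size_rcons.
  move=> av; split.
    apply/avoids_geq_gtP => i j k ij jk kn.
    have := av i j k ij jk (ltnW kn).
    have jn := ltn_trans jk kn; have in_ := ltn_trans ij jn.
    by rewrite !nth_rcons in_ jn kn.
  apply/floor_leP => i j ij jn.
  have := av i j (size e) ij jn (ltnSn _).
  by rewrite !nth_rcons jn (ltn_trans ij jn) ltnn eqxx.
move=> /floor_leP le_x i j k ij jk; rewrite ltnS => le_kn.
have jn := leq_trans jk le_kn; have in_ := ltn_trans ij jn.
rewrite !nth_rcons in_ jn; case: (ltngtP k) le_kn => // [kn|_] _.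
  exact: av.
exact: le_x.
Qed.

Lemma valid_rcons e x : 0 < size e ->
  valid (rcons e x) = valid e && (floor e <= x <= size e).
Proof.
move=> e_gt0; rewrite /valid inversion_sequence_rcons // avoids_geq_gt_rcons.
by rewrite [(floor e <= x) && _]andbC andbACA.
Qed.

Lemma top_lt_size e : valid e -> top e < size e.
Proof.
case/andP => /[dup] /andP[e_gt0 _] /(inversion_sequenceP e_gt0) le_e _.
rewrite -[size e](prednK e_gt0) ltnS.
apply/bigmax_leqP_seq => y /(nthP 0)[i lti <-] _.
by apply: leq_trans (le_e i lti) _; rewrite -ltnS prednK.
Qed.

Lemma floor_le_size e : valid e -> floor e <= size e.
Proof. by move/top_lt_size/ltnW; apply: leq_trans (floor_le_top e). Qed.

Lemma valid_zeros n : valid (nseq n.+1 0).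
Proof.
have nth0 i : nth 0 (nseq n.+1 0) i = 0 by rewrite nth_nseq if_same.
apply/andP; split; last by apply/avoids_geq_gtP => i j k; rewrite !nth0.
by apply/inversion_sequenceP => [|i]; rewrite ?size_nseq // nth0.
Qed.

(** * The tree of right insertions *)

Definition zeros n : inv_geq_gt := exist _ (nseq n.+1 0) (valid_zeros n).

Definition extensions (e : seq nat) : seq (seq nat) :=
  [seq rcons e x | x <- iota (floor e) ((size e).+1 - floor e)].

(** Every extension is admissible, so [insub] discards none of them. *)
Definition append_children (c : inv_geq_gt) : seq inv_geq_gt :=
  pmap insub (extensions (val c)).

Lemma mem_append_children c d :
  reflect (exists x, val d = rcons (val c) x) (d \in append_children c).
Proof.
rewrite mem_pmap_sub; apply: (iffP mapP) => [[x _ ->]|[x def_d]].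
  by exists x.
exists x => //; have := valP d; rewrite /= -/(valid _) def_d.
rewrite valid_rcons ?inv_geq_gt_size_gt0 // mem_iota => /andP[_ /andP[-> le_x]].
by rewrite subnKC // leqW // floor_le_size // (valP c : valid _).
Qed.

Lemma val_append_children c : map val (append_children c) = extensions (val c).
Proof.
rewrite pmap_filter; last exact: insubK.
apply/all_filterP/allP => _ /mapP[x + ->]; rewrite mem_iota => x_range.
rewrite insubT // -/(valid _) valid_rcons ?inv_geq_gt_size_gt0 //.
by rewrite (valP c : valid _); lia.
Qed.

Lemma append_children_uniq c : uniq (append_children c).
Proof.
apply: (pmap_uniq (g := val)); first exact: insubK.
by rewrite map_inj_uniq ?iota_uniq //; apply: rcons_injr.
Qed.

Local Notation append_path := (path (fun x y => y \in append_children x)).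

Lemma append_level (p : seq inv_geq_gt) : append_path (zeros 0) p ->
  size (val (last (zeros 0) p)) = (size p).+1.
Proof.
elim/last_ind: p => //= p d IHp.
rewrite rcons_path last_rcons => /andP[/IHp sz /mem_append_children[x ->]].
by rewrite !size_rcons sz.
Qed.

Lemma append_path_exists (c : inv_geq_gt) :
  exists p, append_path (zeros 0) p /\ last (zeros 0) p = c.
Proof.
have [n] := ubnP (size (val c)); elim: n c => // n IHn c.
move def_c: (val c) => s; case/lastP: s => [|e x] in def_c *.
  by have := inv_geq_gt_size_gt0 c; rewrite def_c.
case: (posnP (size e)) => [/size0nil e0 _|e_gt0].
  exists [::]; split=> //=; apply: val_inj; rewrite def_c e0 /=.
  have [d [_ uniq_d]] := inv_geq_gt_size1.
  have -> : x = head 0 (val c) by rewrite def_c e0.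
  by rewrite -(uniq_d c) ?(uniq_d (zeros 0)) // def_c e0.
have e_valid : valid e.
  by have := valP c; rewrite /= -/(valid _) def_c valid_rcons // => /andP[].
rewrite size_rcons ltnS => lt_en.
have [p [path_p last_p]] := IHn (exist _ e e_valid) lt_en.
exists (rcons p c); rewrite rcons_path path_p last_rcons last_p.
by split=> //; apply/mem_append_children; exists x.
Qed.

(** The last entry of a path determines the one before it, because deleting the
    appended entry gives back the parent. *)
Lemma append_path_inj (p q : seq inv_geq_gt) :
  append_path (zeros 0) p -> append_path (zeros 0) q ->
  last (zeros 0) p = last (zeros 0) q -> p = q.
Proof.
elim/last_ind: p q => [|p d IHp] q path_p path_q eq_last.
  by have := append_level path_q; rewrite -eq_last => -[/esym/size0nil].
case/lastP: q => [|q d'] in path_q eq_last *.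
  by have := append_level path_p; rewrite eq_last size_rcons.
move: path_p path_q eq_last; rewrite !rcons_path !last_rcons.
move=> /andP[path_p /mem_append_children[x def_d]].
move=> /andP[path_q /mem_append_children[y def_d']] eq_d.
rewrite eq_d (IHp q) //; apply: val_inj.
by move: def_d; rewrite eq_d def_d' => /rcons_inj[].
Qed.

Lemma append_tree_path (c : inv_geq_gt) :
  exists! p, append_path (zeros 0) p /\ last (zeros 0) p = c.
Proof.
have [p [path_p last_p]] := append_path_exists c.
exists p; split=> // q [path_q last_q].
by apply: append_path_inj; rewrite ?last_p.
Qed.

Lemma append_tree_infinite n : exists c : inv_geq_gt, n < size (val c).
Proof. by exists (zeros n); rewrite /= size_nseq. Qed.

Lemma append_inserts_entry c d :
  d \in append_children c -> inserts_entry (val c) (val d).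
Proof.
case/mem_append_children => x ->; exists (size (val c)), x.
by rewrite take_size drop_size cats1.
Qed.

Definition append_tree : generating_tree I_geq_gt :=
  @GeneratingTree I_geq_gt (zeros 0) append_children append_children_uniq
    append_tree_path append_level append_tree_infinite append_inserts_entry.

(** * The labels *)

Definition semi_label (e : seq nat) : nat * nat :=
  (top e - floor e + 1, size e - top e).

Lemma semi_label_rcons_le e x : 0 < size e -> floor e <= x <= top e ->
  semi_label (rcons e x) = (top e - x + 1, (size e).+1 - top e).
Proof.
move=> e_gt0 /andP[le_fx le_xt].
rewrite /semi_label size_rcons top_rcons floor_rcons // le_xt.
by rewrite (maxn_idPr le_fx) (maxn_idPl le_xt).
Qed.

Lemma semi_label_rcons_gt e x : 0 < size e -> top e < x ->
  semi_label (rcons e x) = (x - floor e + 1, (size e).+1 - x).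
Proof.
move=> e_gt0 lt_tx.
rewrite /semi_label size_rcons top_rcons floor_rcons // leqNgt lt_tx.
by rewrite (maxn_idPr (ltnW lt_tx)).
Qed.

Lemma rev_iota1 n : rev (iota 1 n) = [seq n - i | i <- iota 0 n].
Proof.
apply: (@eq_from_nth _ 0) => [|i]; first by rewrite size_rev size_map !size_iota.
rewrite size_rev size_iota => lti; rewrite nth_rev ?size_iota //.
by rewrite (nth_map 0) ?size_iota // !nth_iota //; lia.
Qed.

Lemma eq_in_map_perm (T1 T2 : eqType) (f g : T1 -> T2) (s : seq T1) :
  {in s, f =1 g} -> perm_eq (map f s) (map g s).
Proof. by move/eq_in_map->. Qed.

Lemma labels_children e : valid e ->
  perm_eq [seq semi_label f | f <- extensions e]
          (@productions Omega_semi (semi_label e)).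
Proof.
move=> e_valid; have lt_tn := top_lt_size e_valid.
have e_gt0 : 0 < size e by apply: leq_ltn_trans lt_tn.
have le_ft := floor_le_top e.
rewrite /extensions -map_comp /=.
have -> : (size e).+1 - floor e = (top e - floor e + 1) + (size e - top e).
  by lia.
rewrite iotaD map_cat; apply: perm_cat; last first.
  have -> : floor e + (top e - floor e + 1) = top e + 1 by lia.
  rewrite iotaDl -map_comp; apply: eq_in_map_perm => i.
  rewrite mem_iota => i_range /=.
  by rewrite semi_label_rcons_gt //; [congr pair|]; lia.
(* The two lists run through the first components in opposite orders. *)
rewrite perm_sym -perm_rev perm_sym -map_rev rev_iota1 -map_comp.
rewrite -[X in iota X _]addn0 iotaDl -map_comp; apply: eq_in_map_perm => i.
rewrite mem_iota => i_range /=.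
by rewrite semi_label_rcons_le //; [congr pair|]; lia.
Qed.

Theorem proposition17 : grows_according_to I_geq_gt Omega_semi.
Proof.
exists append_tree, (fun c => semi_label (val c)); split=> [|c].
  by rewrite /semi_label /top /floor /= /index_iota /= !unlock.
have := labels_children (valP c); rewrite -val_append_children.
by rewrite -map_comp.
Qed.
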